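(* There exists an absolute constant $c_0>0$ such that for every $p\in[1,2)$, $$\mathcal{E}_0^*(T,r,p)\ \ge\ \frac{c_0DB}{\sqrt T}\cdot\sqrt{\frac{d}{d\wedge r}},$$ where $\mathcal{E}_0^*(T,r,p)$ is the minmax optimization error, defined in the context, for $T$ queries, $r$-bit quantized gradients, dimension $d$, $\ell_p$ diameter $D$ and gradient bound $B$.
   Context: Notation: $a\wedge b=\min\{a,b\}$; $q=p/(p-1)$ is the Hölder conjugate of $p$ ($q=\infty$ for $p=1$). Fix $D,B>0$, the dimension $d$, the number of queries $T\in\mathbb{N}$ and the precision $r\in\mathbb{N}$. Domains: $\mathbb{X}$ is the set of all compact convex sets $\mathcal{X}\subset\mathbb{R}^d$ with $\sup_{x,y\in\mathcal{X}}\|x-y\|_p\le D$. Oracles: for a given $\mathcal{X}$, $\mathcal{O}_{0,p}$ is the class of pairs $(f,O)$ where $f:\mathcal{X}\to\mathbb{R}$ is convex and $O$ is a first-order oracle which, upon a query $x\in\mathcal{X}$, outputs a random vector $\hat g(x)\in\mathbb{R}^d$ such that for all $x\in\mathcal{X}$: $\mathbb{E}[\hat g(x)\mid x]\in\partial f(x)$ and $P(\|\hat g(x)\|_q^2\le B^2\mid x)=1$. Quantizers: an $r$-bit quantizer consists of randomized mappings $(Q^{e},Q^{d})$ (possibly with shared randomness), $Q^{e}:\mathbb{R}^d\to\{0,1\}^r$, $Q^{d}:\{0,1\}^r\to\mathbb{R}^d$, and $Q=Q^{d}\circ Q^{e}$. $\mathcal{Q}_r$ is the set of all $r$-bit quantizers.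 Quantizers are memoryless: each oracle output is quantized without using information from previous rounds. $QO$ denotes the composed oracle that outputs $Q(\hat g(x))$ on query $x$. Protocols: $\Pi_T$ is the set of optimization algorithms $\pi$ making at most $T$ (adaptive) queries to $QO$; the resulting output is $x^*(\pi^{QO})\in\mathcal{X}$. The error is $\mathcal{E}_0(f,\pi^{QO},p)=\mathbb{E}[f(x^*(\pi^{QO}))-\min_{x\in\mathcal{X}}f(x)]$, and $$\mathcal{E}_0^*(T,r,p)=\sup_{\mathcal{X}\in\mathbb{X}}\ \inf_{\pi\in\Pi_T}\ \inf_{Q\in\mathcal{Q}_r}\ \sup_{(f,O)\in\mathcal{O}_{0,p}}\mathcal{E}_0(f,\pi^{QO},p).$$
   Formalization: The formal theorem additionally assumes T ≥ d/(d∧r) (with d, T, r ≥ 1 and nonempty domains): the error never exceeds DB, so for T = r = 1 and large d the bound as stated fails for any absolute c_0. *)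

(* Defs.v *)
From HB Require Import structures.
From mathcomp Require Import all_boot all_order all_algebra.
From mathcomp Require Import all_classical all_reals all_analysis.

Set Implicit Arguments.
Unset Strict Implicit.
Unset Printing Implicit Defensive.

Import Order.TTheory GRing.Theory Num.Theory.
Import numFieldNormedType.Exports.

Local Open Scope classical_set_scope.
Local Open Scope ring_scope.

(* 'M[R]_(m, n), hence R^d = 'rV[R]_d, with its Borel sigma-algebra. *)
HB.instance Definition _ (R : realType) (m n : nat) :=
  @isMeasurable.Build (sigma_display (@open 'M[R]_(m, n))) 'M[R]_(m, n)
    <<s @open 'M[R]_(m, n) >> (@sigma_algebra0 _ setT _) (@sigma_algebraC _ _)
    (@sigma_algebra_bigcup _ setT _).

(* Only indices 1 <= p <= +oo are used. *)
Definition lnorm (R : realType) (d : nat) (p : \bar R) (x : 'rV[R]_d) : R :=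
  match p with
  | r%:E%E => (\sum_(i < d) `|x 0 i| `^ r) `^ r^-1
  | +oo%E => \big[Num.max/0]_(i < d) `|x 0 i|
  | -oo%E => 0
  end.

(* The family of admissible domains. Nonemptiness is implicit in the existence
   of an output x* in X and of min_X f; without it the infimum over algorithms
   would be +oo at X = set0. *)
Definition opt_domain (R : realType) (d : nat) (p D : R) (X : set 'rV[R]_d) :
    Prop :=
  [/\ X !=set0, compact X, convex_set X &
      {in X &, forall x y, lnorm p%:E (x - y) <= D}].

Definition subdifferential (R : realType) (d : nat) (X : set 'rV[R]_d)
    (f : 'rV[R]_d -> R) (x : 'rV[R]_d) : set 'rV[R]_d :=
  [set g | {in X, forall y, f x + \sum_(i < d) g 0 i * (y - x) 0 i <= f y}].

(* A first-order oracle orc is a Markov kernel: orc x is the law of the answer to the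
   query x, and distinct queries are answered with fresh randomness. Functions
   and oracles are total, but only their values on X matter. *)
Definition oracle (R : realType) (d : nat) := R.-pker 'rV[R]_d ~> 'rV[R]_d.

Definition oracle_class (R : realType) (d : nat) (p B : R) (X : set 'rV[R]_d) :
    set (('rV[R]_d -> R) * oracle R d) :=
  [set fO : ('rV[R]_d -> R) * oracle R d | convex_function X fO.1 /\
    {in X, forall x : 'rV[R]_d,
      subdifferential X fO.1 x
        (\row_(i < d) (\int[fO.2 x]_g (g : 'rV[R]_d) 0 i)) /\
      fO.2 x [set g | lnorm (hoelder_conjugate p%:E) g ^+ 2 <= B ^+ 2]
        = 1%E}].

(* The kernels carry the private randomness of the encoder and of the decoder;
   the probability q_law on q_space is their shared randomness. *)
Record quantizer (R : realType) (d r : nat) := Quantizer {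
  q_disp : measure_display;
  q_space : measurableType q_disp;
  q_law : probability q_space R;
  q_enc : R.-pker (q_space * 'rV[R]_d) ~> (r.-tuple bool);
  q_dec : R.-pker (q_space * (r.-tuple bool)) ~> 'rV[R]_d }.

(* Expectation of phi (Q (ghat x)), where phi >= 0. *)
Definition quantized_oracle_expect (R : realType) (d r : nat)
    (Q : quantizer R d r) (orc : oracle R d) (x : 'rV[R]_d)
    (phi : 'rV[R]_d -> \bar R) : \bar R :=
  (\int[q_law Q]_u (\int[orc x]_g (\int[q_enc Q (u, g)]_m
     (\int[q_dec Q (u, m)]_y phi y))))%E.

(* An algorithm with T rounds and internal randomness of law a_law. A tuple in
   t.-tuple 'rV_d lists the first t answers, the most recent one first; given
   them, a_query t is the next query (relevant for t < T). Stopping early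
   amounts to ignoring the last answers. *)
Record algorithm (R : realType) (d T : nat) (X : set 'rV[R]_d) := Algorithm {
  a_disp : measure_display;
  a_space : measurableType a_disp;
  a_law : probability a_space R;
  a_query : forall t : nat, a_space * t.-tuple 'rV[R]_d -> 'rV[R]_d;
  a_out : a_space * T.-tuple 'rV[R]_d -> 'rV[R]_d;
  a_query_measurable : forall t, measurable_fun setT (@a_query t);
  a_out_measurable : measurable_fun setT a_out;
  a_query_dom : forall t sh, X (@a_query t sh);
  a_out_dom : forall sh, X (a_out sh) }.
Arguments a_query {R d T X} a t _ : rename.
Arguments a_out {R d T X} a _ : rename.

(* Expectation of phi applied to the first t answers of the composed oracle QO,
   for the value s of the internal randomness. *)
Fixpoint answers_expect (R : realType) (d r T : nat) (X : set 'rV[R]_d)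
    (pi : algorithm T X) (Q : quantizer R d r) (orc : oracle R d)
    (s : a_space pi) (t : nat) : (t.-tuple 'rV[R]_d -> \bar R) -> \bar R :=
  match t with
  | 0 => fun phi => phi [tuple]
  | t'.+1 => fun phi => answers_expect Q orc s
      (fun h : t'.-tuple 'rV[R]_d =>
         quantized_oracle_expect Q orc (a_query pi t' (s, h))
           (fun y => phi [tuple of y :: h]))
  end.

(* On the oracle class, f is Lipschitz on the compact set X, so that inf is a
   minimum. *)
Definition opt_error (R : realType) (d r T : nat) (X : set 'rV[R]_d)
    (pi : algorithm T X) (Q : quantizer R d r) (f : 'rV[R]_d -> R)
    (orc : oracle R d) : \bar R :=
  (\int[a_law pi]_s answers_expect Q orc s
     (fun h : T.-tuple 'rV[R]_d => (f (a_out pi (s, h)) - inf (f @` X))%:E))%E.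

(* The ranges over algorithm and quantizer are written with exists rather than
   as images, since these types are too large to be the carrier of a set. *)
Definition minmax_error (R : realType) (d T r : nat) (p D B : R) : \bar R :=
  ereal_sup [set
    ereal_inf [set e | exists pi : algorithm T X,
      ereal_inf [set e' | exists Q : quantizer R d r,
        ereal_sup [set opt_error pi Q fO.1 fO.2 | fO in oracle_class p B X]
        = e'] = e]
  | X in [set X : set 'rV[R]_d | opt_domain p D X]].

(* Main.v *)
(** Take for [X] a cube and for [f] a linear cost whose coefficients have fixed
    modulus and signs [v]; the oracle ignores the query and answers with
    independent random signs of bias [del] towards [v]. A suboptimal sign in one
    coordinate of the output costs the same in every coordinate, so it is enough
    to show that, on average over [v], a constant fraction of the signs cannot
    be recovered. If the messages under [v] and [flip i v] are at chi-square
    divergence [D_i], then [T] answers cannot tell [v] and [flip i v] apart as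
    long as [T * D_i] is small (Assouad). For messages of [r] bits
    [\sum_i D_i <= 128 * del ^+ 2 * minn d r]: the bound by [d] is trivial, the
    bound by [r] is the level-1 inequality. Hence [del ^+ 2] may be taken of
    order [d / (T * minn d r)], and the error is of order [D * B * del]. *)
Require Import Defs.
From HB Require Import structures.
From mathcomp Require Import all_boot all_order all_algebra.
From mathcomp Require Import all_classical all_reals all_analysis.
From mathcomp Require Import measurable_realfun ring lra.

Set Implicit Arguments.
Unset Strict Implicit.
Unset Printing Implicit Defensive.

Import Order.TTheory GRing.Theory Num.Theory.
Import numFieldNormedType.Exports.

Local Open Scope classical_set_scope.
Local Open Scope ring_scope.

(** * Biased random signs: product law on the cube, likelihood ratios, exponential moments *)

Definition bias (R : realType) (del : R) (a b : bool) : R :=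
  (1 + (if a == b then del else - del)) / 2.

Definition flip (d : nat) (i : 'I_d) (v : {ffun 'I_d -> bool}) :
    {ffun 'I_d -> bool} :=
  [ffun j => if j == i then ~~ v j else v j].

Definition cube_law (R : realType) (d : nat) (del : R)
    (v x : {ffun 'I_d -> bool}) : R :=
  \prod_(i < d) bias del (v i) (x i).

(** Likelihood ratio of the two hypotheses on one sign, minus one; it is centred under
    [bias del a]. *)
Definition score (R : realType) (del : R) (a b : bool) : R :=
  bias del (~~ a) b / bias del a b - 1.

(** [e m x] is to be read as the probability that the encoder sends [m] on the sign vector [x]. *)
Definition message_law (R : realType) (d : nat) (del : R) (M : Type)
    (e : M -> {ffun 'I_d -> bool} -> R) (v : {ffun 'I_d -> bool}) (m : M) : R :=
  \sum_x cube_law del v x * e m x.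

Lemma flipK (d : nat) (i : 'I_d) : involutive (flip i).
Proof.
by move=> v; apply/ffunP => j; rewrite !ffunE; case: eqP => // _; rewrite negbK.
Qed.

Lemma bias_gt0 (R : realType) (del : R) a b : 0 < del < 1 -> 0 < bias del a b.
Proof. by move=> ?; rewrite /bias; case: ifP => _; lra. Qed.

Lemma sum_bias (R : realType) (del : R) a : \sum_(b : bool) bias del a b = 1.
Proof. by rewrite big_bool /bias; case: a => /=; field. Qed.

Lemma sum_bias_score (R : realType) (del : R) a : 0 < del < 1 ->
  \sum_(b : bool) bias del a b * score del a b = 0.
Proof.
move=> d01; have H b : bias del a b * score del a b =
    bias del (~~ a) b - bias del a b.
  rewrite /score mulrBr mulr1 mulrC -mulrA mulVf ?mulr1//.
  by rewrite gt_eqF// bias_gt0.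
by rewrite (eq_bigr _ (fun b _ => H b)) sumrB !sum_bias subrr.
Qed.

(** The two biases differ by [del], and the denominator is at least 1/4 because [del] is at most
    1/2. *)
Lemma score_le (R : realType) (del : R) a b : 0 < del <= 2^-1 ->
  `|score del a b| <= 4 * del.
Proof.
move=> d01; rewrite ler_norml /score.
have b0 : 0 < bias del a b by apply: bias_gt0; lra.
rewrite lerBrDr lerBlDr ler_pdivlMr// ler_pdivrMr// /bias.
by case: a b {b0} => -[] /=; apply/andP; split; nra.
Qed.

Lemma cube_law_gt0 (R : realType) d (del : R) (v x : {ffun 'I_d -> bool}) :
  0 < del < 1 -> 0 < cube_law del v x.
Proof. by move=> h; apply: prodr_gt0 => i _; apply: bias_gt0. Qed.

Lemma expect_cube_prod (R : realType) d (del : R) (v : {ffun 'I_d -> bool})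
    (F : 'I_d -> bool -> R) :
  \sum_x cube_law del v x * \prod_i F i (x i) =
  \prod_i \sum_(b : bool) bias del (v i) b * F i b.
Proof.
rewrite bigA_distr_bigA; apply: eq_bigr => x _.
by rewrite -big_split.
Qed.

Lemma sum_cube_law (R : realType) d (del : R) (v : {ffun 'I_d -> bool}) :
  \sum_x cube_law del v x = 1.
Proof.
have := expect_cube_prod del v (fun _ _ => 1) => /=.
under eq_bigr do rewrite big1_eq mulr1.
move=> ->; apply: big1 => i _; under eq_bigr do rewrite mulr1.
exact: sum_bias.
Qed.

Lemma expect_cube_coord (R : realType) d (del : R) (v : {ffun 'I_d -> bool})
    (i : 'I_d) (F : bool -> R) :
  \sum_x cube_law del v x * F (x i) =
  \sum_(b : bool) bias del (v i) b * F b.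
Proof.
have := expect_cube_prod del v (fun j b => if j == i then F b else 1) => /=.
under eq_bigr => x _.
  rewrite (bigD1 i)//= eqxx big1 ?mulr1; last by move=> j /negPf ->.
  over.
move=> ->; rewrite (bigD1 i)//= eqxx [X in _ * X]big1 ?mulr1// => j /negPf ->.
by under eq_bigr do rewrite mulr1; exact: sum_bias.
Qed.

Lemma cube_law_flip (R : realType) d (del : R) (v : {ffun 'I_d -> bool}) x
    (i : 'I_d) : 0 < del < 1 ->
  cube_law del (flip i v) x =
  cube_law del v x * (1 + score del (v i) (x i)).
Proof.
move=> d01; rewrite /cube_law (bigD1 i)//= [in RHS](bigD1 i)//=.
rewrite ffunE eqxx /score addrCA subrr addr0 [RHS]mulrAC mulrCA mulfV.
  rewrite mulr1; congr (_ * _); apply: eq_bigr => j /negPf ji.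
  by rewrite ffunE ji.
by rewrite gt_eqF// bias_gt0.
Qed.

(** From [expR (- x) >= 1 - x], [expR x] is at most the inverse of [1 - x]; and [(1 + x + 2 * x ^+
    2) * (1 - x) = 1 + x ^+ 2 * (1 - 2 * x)] is at least 1 for [x] up to 1/2. *)
Lemma expR_le_quad (R : realType) (x : R) : `|x| <= 2^-1 ->
  expR x <= 1 + x + 2 * x ^+ 2.
Proof.
rewrite ler_norml => /andP[x1 x2].
have h := expR_ge1Dx (- x).
have e0 := expR_gt0 (- x).
rewrite -[leLHS]invrK -expRN invf_ple ?posrE//; last by nra.
apply: le_trans h.
by rewrite -[leLHS]mul1r ler_pdivrMr; nra.
Qed.

(** The score is centred, so only the quadratic term of [expR_le_quad] contributes, with
    [2 * (4 * del) ^+ 2 = 32 * del ^+ 2]. The bound on [s] keeps the exponent within 1/2. *)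
Lemma score_mgf (R : realType) (del s : R) a : 0 < del <= 2^-1 ->
  `|s| * (8 * del) <= 1 ->
  \sum_(b : bool) bias del a b * expR (s * score del a b) <=
  expR (32 * del ^+ 2 * s ^+ 2).
Proof.
move=> d01 hs.
have d1 : 0 < del < 1 by lra.
apply: le_trans (expR_ge1Dx _).
have -> : 1 + 32 * del ^+ 2 * s ^+ 2 =
    \sum_(b : bool) bias del a b * (1 + s * score del a b + 32 * del ^+ 2 * s ^+ 2).
  under [RHS]eq_bigr do rewrite 2!mulrDr mulr1 mulrCA.
  rewrite !big_split/= sum_bias -mulr_sumr sum_bias_score// mulr0 addr0.
  by rewrite -mulr_suml sum_bias mul1r.
apply: ler_sum => b _; apply: ler_wpM2l; first exact/ltW/bias_gt0.
have sc := score_le a b d01.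
apply: le_trans (expR_le_quad _) _.
  rewrite normrM; apply: le_trans (ler_wpM2l (normr_ge0 s) sc) _; lra.
rewrite lerD2l exprMn.
have : score del a b ^+ 2 <= (4 * del) ^+ 2.
  by rewrite -real_normK ?num_real// lerXn2r// ?nnegrE; lra.
by have := sqr_ge0 s; nra.
Qed.

(** * Chi-square divergence of one message under single sign flips *)

Section posterior.
Variables (R : realType) (d r : nat) (del : R) (M : finType).
Variable e : M -> {ffun 'I_d -> bool} -> R.
Variable v : {ffun 'I_d -> bool}.
Hypothesis del_range : 0 < del <= 2^-1.
Hypothesis e_ge0 : forall m x, 0 <= e m x.
Hypothesis sum_e : forall x, \sum_m e m x = 1.

Let P := cube_law del v.
Let w := message_law del e.
Let xi (i : 'I_d) (x : {ffun 'I_d -> bool}) := score del (v i) (x i).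
(** Conditional mean of the score of coordinate [i] given the message [m]; division by zero makes it
    0 for messages that are never sent. *)
Let mu (i : 'I_d) m := (\sum_x P x * e m x * xi i x) / w v m.
Let S m := \sum_i mu i m ^+ 2.

Let del1 : 0 < del < 1. Proof. by move: del_range => ?; lra. Qed.

Lemma message_law_ge0 u m : 0 <= w u m.
Proof. by apply: sumr_ge0 => x _; rewrite mulr_ge0// ltW// cube_law_gt0. Qed.

Lemma sum_message_law u : \sum_m w u m = 1.
Proof.
rewrite exchange_big/= -[RHS](sum_cube_law del u); apply: eq_bigr => x _.
by rewrite -mulr_sumr sum_e mulr1.
Qed.

(** [cube_law] charges every point, so a message of probability zero under one [u] is never sent at
    all. All message laws are thus mutually absolutely continuous. *)
Lemma message_law_eq0 u m : w u m = 0 -> forall x, e m x = 0.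
Proof.
move=> /eqP; rewrite psumr_eq0 => [/allP h x|x _]; last first.
  by rewrite mulr_ge0// ltW// cube_law_gt0.
have := h x (mem_index_enum x); rewrite mulf_eq0 gt_eqF ?cube_law_gt0//=.
by move=> /eqP.
Qed.

Let muE i m : \sum_x P x * e m x * xi i x = w v m * mu i m.
Proof.
rewrite /mu; have [w0|w0] := eqVneq (w v m) 0; last by rewrite mulrC divfK.
rewrite w0 mul0r big1// => x _.
by rewrite (message_law_eq0 w0) mulr0 mul0r.
Qed.

(** The likelihood ratio of a message is the conditional mean, given that message, of the likelihood
    ratio of [x]. *)
Let w_flip i m : w (flip i v) m = w v m * (1 + mu i m).
Proof.
rewrite mulrDr mulr1 -muE -big_split/=; apply: eq_bigr => x _.
by rewrite cube_law_flip// /xi /P; ring.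
Qed.

(** Each summand expands to [2 * w (flip i v) m - w v m + w v m * mu i m ^+ 2], and both laws have
    mass one: the chi-square divergence is the second moment of [mu i]. *)
Let chi2E : \sum_i \sum_m w (flip i v) m ^+ 2 / w v m =
  d%:R + \sum_m w v m * S m.
Proof.
have -> : \sum_m w v m * S m = \sum_i \sum_m w v m * mu i m ^+ 2.
  by rewrite exchange_big/=; apply: eq_bigr => m _; rewrite mulr_sumr.
rewrite -[d in d%:R]card_ord -sum1_card natr_sum -big_split/=.
apply: eq_bigr => i _.
have h m : w (flip i v) m ^+ 2 / w v m =
    2 * w (flip i v) m - w v m + w v m * mu i m ^+ 2.
  rewrite !w_flip; have [->|w0] := eqVneq (w v m) 0.
    by rewrite invr0 !mul0r !mulr0; ring.
  by field.
rewrite (eq_bigr _ (fun m _ => h m)) !big_split/= sumrN -mulr_sumr.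
by rewrite !sum_message_law; ring.
Qed.

Let mu_le i m : `|mu i m| <= 4 * del.
Proof.
have [w0|w0] := eqVneq (w v m) 0.
  by rewrite /mu w0 invr0 mulr0 normr0 mulr_ge0//; case/andP: del_range => /ltW.
have wp : 0 < w v m by rewrite lt_def w0 message_law_ge0.
rewrite /mu normrM normfV (gtr0_norm wp) ler_pdivrMr//.
apply: le_trans (ler_norm_sum _ _ _) _.
rewrite mulr_sumr; apply: ler_sum => x _.
have h : 0 <= P x * e m x by rewrite mulr_ge0// ltW// cube_law_gt0.
by rewrite normrM ger0_norm// mulrC ler_wpM2r// score_le.
Qed.

Let S_le_dim : \sum_m w v m * S m <= 16 * del ^+ 2 * d%:R.
Proof.
have h m : S m <= 16 * del ^+ 2 * d%:R.
  apply: (@le_trans _ _ (\sum_(i < d) 16 * del ^+ 2)); last first.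
    by rewrite sumr_const card_ord mulr_natr.
  apply: ler_sum => i _; have := mu_le i m; rewrite ler_norml => /andP[? ?].
  nra.
apply: (@le_trans _ _ (\sum_m w v m * (16 * del ^+ 2 * d%:R))).
  by apply: ler_sum => m _; rewrite ler_wpM2l// message_law_ge0.
by rewrite -mulr_suml sum_message_law mul1r.
Qed.

(* Level-1 inequality. The exponential moment of [Y m] is at most [1], and
   [Y m - r <= expR (Y m - r) - 1] turns this into a bound on the mean of [Y m]
   given the message, in which the [2 ^ r] messages only cost [r]. *)
Let S_le_bits : #|M| = (2 ^ r)%N -> \sum_m w v m * S m <= 128 * del ^+ 2 * r%:R.
Proof.
move=> cardM; have d0 : 0 < del by case/andP: del_range.
(* Maximiser of [lam - 32 * del ^+ 2 * lam ^+ 2]. It gives [c = lam / 2], so that half of the linear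
   term survives. *)
pose lam := (64 * del ^+ 2)^-1.
have lam0 : 0 < lam by rewrite invr_gt0 mulr_gt0// exprn_gt0.
have lamE : lam * (64 * del ^+ 2) = 1.
  by rewrite mulVf// gt_eqF// mulr_gt0// exprn_gt0.
pose c := 32 * del ^+ 2 * lam ^+ 2.
pose Y m x := lam * (\sum_i mu i m * xi i x) - c * S m.
have mgf m : \sum_x P x * expR (Y m x) <= 1.
  have -> : \sum_x P x * expR (Y m x) = expR (- (c * S m)) *
      \sum_x P x * \prod_i expR (lam * mu i m * score del (v i) (x i)).
    rewrite mulr_sumr; apply: eq_bigr => x _.
    have -> : Y m x = - (c * S m) +
        \sum_i lam * mu i m * score del (v i) (x i).
      rewrite /Y addrC; congr (_ + _); rewrite mulr_sumr.
      by apply: eq_bigr => i _; rewrite mulrA.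
    by rewrite expRD expR_sum mulrCA.
  rewrite (expect_cube_prod del v
    (fun i b => expR (lam * mu i m * score del (v i) b))) expRN mulrC.
  rewrite ler_pdivrMr ?expR_gt0// mul1r.
  rewrite /S mulr_sumr expR_sum; apply: ler_prod => i _.
  apply/andP; split.
    by apply: sumr_ge0 => b _; rewrite mulr_ge0 ?expR_ge0// ltW// bias_gt0.
  apply: le_trans (score_mgf _ del_range _) _.
    (* Here [lam * (4 * del) * (8 * del)] equals 1/2, within the range of [score_mgf]. *)
    rewrite normrM gtr0_norm//; have := mu_le i m.
    have := normr_ge0 (mu i m); nra.
  by rewrite ler_expR /c exprMn le_eqVlt; apply/orP; left; apply/eqP; ring.
have key m : \sum_x P x * e m x * (\sum_i mu i m * xi i x) = w v m * S m.
  under eq_bigr do rewrite mulr_sumr.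
  rewrite exchange_big mulr_sumr /=; apply: eq_bigr => i _.
  transitivity (mu i m * \sum_x P x * e m x * xi i x).
    by rewrite mulr_sumr; apply: eq_bigr => x _; ring.
  by rewrite muE; ring.
have mean m : \sum_x P x * e m x * Y m x = lam / 2 * (w v m * S m).
  transitivity (lam * (w v m * S m) - c * S m * w v m).
    have -> : c * S m * w v m = \sum_x P x * e m x * (c * S m).
      by rewrite -mulr_suml mulrC.
    rewrite -key [X in X - _]mulr_sumr -sumrB.
    by apply: eq_bigr => x _; rewrite /Y; ring.
  have -> : c = lam * (lam * (64 * del ^+ 2)) / 2 by rewrite /c; field.
  by rewrite lamE; field.
(* Bounding [e m x] by 1 in front of the nonnegative exponential forgets the encoder: each message
   then costs at most [expR (- r%:R)], whatever its probability. *)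
have bound m : lam / 2 * (w v m * S m) - r%:R * w v m <= expR (- r%:R) - w v m.
  rewrite -mean; apply: (@le_trans _ _
      (\sum_x (expR (- r%:R) * (P x * expR (Y m x)) - P x * e m x))).
    rewrite mulr_sumr -sumrB; apply: ler_sum => x _.
    have P0 : 0 < P x := cube_law_gt0 v x del1.
    have e1 : e m x <= 1.
      by rewrite -(sum_e x) (bigD1 m)//= lerDl sumr_ge0.
    have := expR_ge1Dx (Y m x - r%:R); rewrite expRD => h.
    have E0 : 0 <= expR (Y m x) * expR (- r%:R).
      by rewrite mulr_ge0 ?expR_ge0.
    have em := e_ge0 m x.
    rewrite [leLHS](_ : _ = P x * (e m x * (Y m x - r%:R))); last first.
      by rewrite /P; ring.
    rewrite [leRHS](_ : _ = P x * (expR (Y m x) * expR (- r%:R) - e m x)); last first.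
      by ring.
    rewrite ler_pM2l//.
    apply: (@le_trans _ _ (e m x * (expR (Y m x) * expR (- r%:R)) - e m x)); nra.
  rewrite sumrB -mulr_sumr lerD2r ler_piMr ?expR_ge0//.
have := @ler_sum _ _ (index_enum M) xpredT _ _ (fun m _ => bound m).
rewrite !sumrB -!mulr_sumr sum_message_law sumr_const cardM mulr1.
(* Since [2 <= expR 1], the [2 ^ r] messages together cost at most 1, which the total mass of the
   message law, subtracted on the same side, cancels. *)
have r2 : expR (- r%:R) *+ (2 ^ r) <= 1 :> R.
  rewrite -[leLHS]mulr_natl natrX expRN ler_pdivrMr ?expR_gt0// mul1r.
  rewrite -[r%:R]mulr1 expRM_natl lerXn2r ?nnegrE ?expR_ge0//.
  by have := expR_ge1Dx (1 : R).
move=> h; have {h r2} : lam / 2 * \sum_m w v m * S m <= r%:R by lra.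
rewrite -ler_pdivlMl; last by lra.
move=> /le_trans; apply; rewrite /lam invf_div invrK le_eqVlt.
by apply/orP; left; apply/eqP; ring.
Qed.

Lemma sum_chi2_flip : #|M| = (2 ^ r)%N ->
  \sum_i \sum_m w (flip i v) m ^+ 2 / w v m <=
  d%:R + 128 * del ^+ 2 * (minn d r)%:R.
Proof.
move=> cardM; rewrite chi2E lerD2l /minn; case: ifP => _; last exact: S_le_bits.
apply: le_trans S_le_dim _; rewrite ler_wpM2r//.
by have := sqr_ge0 del; lra.
Qed.

End posterior.

(** * Integration over finite message sets, finitely supported laws, pulled-back kernels *)

Lemma measurable_tuple_bool (r : nat) (A : set (r.-tuple bool)) : measurable A.
Proof.
have m1 (m : r.-tuple bool) : measurable [set m].
  have -> : [set m] =
      \bigcap_(i in [set: 'I_r]) ((fun x => tnth x i) @^-1` [set tnth m i]).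
    apply/seteqP; split => [x -> //|x /= h].
    by apply: eq_from_tnth => i; apply: h.
  apply: fin_bigcap_measurable => // i _.
  by rewrite -[X in measurable X]setTI; apply: measurable_tnth.
apply: countable_measurable => //; first exact: countableP.
Qed.

Lemma integral_tuple_bool (R : realType) (r : nat)
    (mu : {measure set (r.-tuple bool) -> \bar R}) (f : r.-tuple bool -> \bar R) :
  (forall m, 0 <= f m)%E ->
  (\int[mu]_m f m = \sum_(m : r.-tuple bool) mu [set m] * f m)%E.
Proof.
move=> f0.
transitivity (\int[mu]_x (\sum_(m : r.-tuple bool) f m * (\1_[set m] x)%:E))%E.
  apply: eq_integral => x _; rewrite (bigD1 x)//= big1 ?adde0.
    by rewrite indicE mem_set// mule1.
  by move=> m mx; rewrite indicE memNset ?mule0// => xm; rewrite xm eqxx in mx.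
have mA (g : r.-tuple bool -> \bar R) : measurable_fun setT g.
  by move=> _ Y _; apply: measurable_tuple_bool.
rewrite ge0_integral_sum//; last by move=> m x _; rewrite mule_ge0.
apply: eq_bigr => m _; rewrite ge0_integralZl// muleC; congr (_ * _)%E.
by rewrite integral_indic ?setIT//; apply: measurable_tuple_bool.
Qed.

Section finite_law.
Context {dY : measure_display} {Y : measurableType dY} {R : realType}.
Variables (T : finType) (p : T -> R) (g : T -> Y).

(* The absolute value only makes [finite_law] a measure for every [p]. *)
Definition finite_law of (\sum_x `|p x| = 1) := msum (fun k : nat =>
  if insub k is Some i
  then mscale (NngNum (normr_ge0 (p (@enum_val T T i)))) \d_(g (enum_val i))
  else mzero) #|T|.

Hypothesis sum_p : \sum_x `|p x| = 1.

HB.instance Definition _ := Measure.on (finite_law sum_p).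

Lemma finite_lawE (A : set Y) :
  (finite_law sum_p A = \sum_x `|p x|%:E * \d_(g x) A)%E.
Proof.
rewrite /finite_law /msum [RHS](eq_bigl (mem T))// [RHS]big_enum_val.
apply: eq_bigr => i _.
by rewrite valK.
Qed.

Let finite_law_setT : finite_law sum_p setT = 1%E.
Proof.
rewrite finite_lawE; under eq_bigr do rewrite diracT mule1.
by rewrite sumEFin sum_p.
Qed.

HB.instance Definition _ :=
  Measure_isProbability.Build _ _ _ (finite_law sum_p) finite_law_setT.

Lemma integral_finite_law (f : Y -> \bar R) : measurable_fun setT f ->
  (forall y, 0 <= f y)%E ->
  (\int[finite_law sum_p]_y f y = \sum_x `|p x|%:E * f (g x))%E.
Proof.
move=> mf f0; rewrite ge0_integral_measure_sum//.
rewrite [RHS](eq_bigl (mem T))// [RHS]big_enum_val.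
apply: eq_bigr => i _; rewrite valK ge0_integral_mscale//.
by rewrite integral_dirac// diracT mul1e.
Qed.

End finite_law.

Section pullback_kernel.
Context {d1 d2 d3 : measure_display} {X : measurableType d1}
  {X' : measurableType d2} {Y : measurableType d3} {R : realType}.
Variables (f : X -> X') (k : R.-pker X' ~> Y).

Definition kpullback of measurable_fun setT f :
  X -> {measure set Y -> \bar R} := fun x => k (f x).

Hypothesis mf : measurable_fun setT f.

Let measurable_kpullback (A : set Y) :
  measurable A -> measurable_fun setT (kpullback mf ^~ A).
Proof. by move=> mA; apply: measurableT_comp (measurable_kernel k A mA) mf. Qed.

HB.instance Definition _ :=
  isKernel.Build _ _ _ _ _ (kpullback mf) measurable_kpullback.

Let kpullback_setT x : kpullback mf x setT = 1%E.
Proof. exact: prob_kernel. Qed.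

HB.instance Definition _ :=
  Kernel_isProbability.Build _ _ _ _ _ (kpullback mf) kpullback_setT.

End pullback_kernel.

(** * One answer through a channel with shared randomness and finitely many messages *)

Section channel.
Context {dU dY : measure_display} {U : measurableType dU} {Y : measurableType dY}
  {R : realType}.
Variables (law : probability U R) (M : finType) (dec : M -> R.-pker U ~> Y).
Local Open Scope ereal_scope.

(** [u] is the shared randomness, [w u] the law of the message, [dec m u] the law of the decoded
    answer. Only [w] will depend on the hidden signs. *)
Definition channel_expect (w : U -> M -> R) (phi : Y -> \bar R) : \bar R :=
  \int[law]_u \sum_m (w u m)%:E * \int[dec m u]_y phi y.

(** Mean over [t] independent answers, stacked with the latest first as in [answers_expect]. *)
Fixpoint iter_channel (w : U -> M -> R) (t : nat) :
    (t.-tuple Y -> \bar R) -> \bar R :=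
  match t with
  | 0 => fun phi => phi [tuple]
  | t'.+1 => fun phi => iter_channel w (fun h : t'.-tuple Y =>
      channel_expect w (fun y => phi [tuple of y :: h]))
  end.

Definition transition_weight (w : U -> M -> R) : Prop :=
  [/\ forall u m, (0 <= w u m)%R, forall u, (\sum_m w u m = 1)%R &
      forall m, measurable_fun setT (w ^~ m)].

Lemma measurable_decode (dZ : measure_display) (Z : measurableType dZ)
    (F : Z * Y -> \bar R) m :
  measurable_fun setT F -> (forall z, 0 <= F z) ->
  measurable_fun setT (fun zu : Z * U => \int[dec m zu.2]_y F (zu.1, y)).
Proof.
move=> mF F0.
apply: (measurable_fun_integral_finite_kernel
  (fun x : (Z * U) * Y => F (x.1.1, x.2))
  (kpullback (dec m) (@measurable_snd _ _ Z U))) => //.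
apply: measurableT_comp mF _; apply: measurable_fun_pair => //.
exact: measurableT_comp measurable_fst measurable_fst.
Qed.

Lemma measurable_decode1 (phi : Y -> \bar R) m : measurable_fun setT phi ->
  (forall y, 0 <= phi y) -> measurable_fun setT (fun u => \int[dec m u]_y phi y).
Proof.
move=> mphi phi0; apply: measurable_fun_integral_kernel => //.
exact: measurable_kernel.
Qed.

Lemma measurable_mixture w (phi : Y -> \bar R) : transition_weight w ->
  measurable_fun setT phi -> (forall y, 0 <= phi y) ->
  measurable_fun setT (fun u => \sum_m (w u m)%:E * \int[dec m u]_y phi y).
Proof.
move=> [_ _ mw] mphi phi0; apply: emeasurable_sum => m.
apply: emeasurable_funM; last exact: measurable_decode1.
exact/measurable_EFinP.
Qed.

Lemma measurable_chi2_weight (wP wQ : U -> M -> R) :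
  transition_weight wP -> transition_weight wQ ->
  measurable_fun setT (fun u => (\sum_m wQ u m ^+ 2 / wP u m)%R).
Proof.
move=> [P0 _ mP] [_ _ mQ]; apply: measurable_sum => m; apply: measurable_funM.
  exact: measurable_funX.
(* The inverse is rewritten as the power -1 to obtain measurability; the two agree on nonnegative
   reals, 0 included. *)
have -> : (fun u => (wP u m)^-1%R) = (@powR R ^~ (- 1)%R) \o (wP ^~ m).
  by apply/funext => u /=; rewrite powR_inv1.
exact: measurableT_comp.
Qed.

Lemma decode_ge0 (phi : Y -> \bar R) m u :
  (forall y, 0 <= phi y) -> 0 <= \int[dec m u]_y phi y.
Proof. by move=> phi0; apply: integral_ge0. Qed.

Lemma channel_expect_ge0 w (phi : Y -> \bar R) : transition_weight w ->
  (forall y, 0 <= phi y) -> 0 <= channel_expect w phi.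
Proof.
move=> [w0 _ _] phi0; apply: integral_ge0 => u _; apply: sume_ge0 => m _.
by rewrite mule_ge0 ?lee_fin// decode_ge0.
Qed.

Lemma measurable_channel_expect (dZ : measure_display) (Z : measurableType dZ) w
    (F : Z * Y -> \bar R) : transition_weight w ->
  measurable_fun setT F -> (forall z, 0 <= F z) ->
  measurable_fun setT (fun z => channel_expect w (fun y => F (z, y))).
Proof.
move=> [w0 _ mw] mF F0.
apply: (@measurable_fun_fubini_tonelli_F _ _ Z U R law
  (fun zu => \sum_m (w zu.2 m)%:E * \int[dec m zu.2]_y F (zu.1, y))).
  apply: emeasurable_sum => m; apply: emeasurable_funM; last exact: measurable_decode.
  apply/measurable_EFinP; exact: measurableT_comp (mw m) measurable_snd.
by move=> zu; apply: sume_ge0 => m _; rewrite mule_ge0 ?lee_fin// decode_ge0.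
Qed.

Lemma channel_expect_sum (I : Type) (s : seq I) w (phi : I -> Y -> \bar R) :
  transition_weight w -> (forall i, measurable_fun setT (phi i)) ->
  (forall i y, 0 <= phi i y) ->
  channel_expect w (fun y => \sum_(i <- s) phi i y) =
  \sum_(i <- s) channel_expect w (phi i).
Proof.
move=> W; have [w0 _ _] := W; move=> mphi phi0.
rewrite -ge0_integral_sum//; first last.
- by move=> i u _; apply: sume_ge0 => m _; rewrite mule_ge0 ?lee_fin// decode_ge0.
- by move=> i; apply: measurable_mixture.
apply: eq_integral => u _; rewrite exchange_big/=; apply: eq_bigr => m _.
rewrite ge0_integral_sum// ge0_sume_distrr// => i _; exact: decode_ge0.
Qed.

Lemma channel_expectZ (c : R) w (phi : Y -> \bar R) :
  transition_weight w -> measurable_fun setT phi -> (forall y, 0 <= phi y) ->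
  (0 <= c)%R ->
  channel_expect w (fun y => c%:E * phi y) = c%:E * channel_expect w phi.
Proof.
move=> W; have [w0 _ _] := W; move=> mphi phi0 c0.
rewrite -ge0_integralZl//; first last.
- by move=> u _; apply: sume_ge0 => m _; rewrite mule_ge0 ?lee_fin// decode_ge0.
- exact: measurable_mixture.
apply: eq_integral => u _; rewrite ge0_sume_distrr; last first.
  by move=> m _; rewrite mule_ge0 ?lee_fin// decode_ge0.
by apply: eq_bigr => m _; rewrite ge0_integralZl// muleCA.
Qed.

Lemma channel_expect_le w (phi psi : Y -> \bar R) :
  transition_weight w -> measurable_fun setT phi -> measurable_fun setT psi ->
  (forall y, 0 <= phi y) -> (forall y, phi y <= psi y) ->
  channel_expect w phi <= channel_expect w psi.
Proof.
move=> W; have [w0 _ _] := W; move=> mphi mpsi phi0 h.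
have psi0 y : 0 <= psi y := le_trans (phi0 y) (h y).
apply: ge0_le_integral => //.
- by move=> u _; apply: sume_ge0 => m _; rewrite mule_ge0 ?lee_fin// decode_ge0.
- exact: measurable_mixture.
- exact: measurable_mixture.
move=> u _; apply: lee_sum => m _; rewrite lee_wpmul2l ?lee_fin//.
exact: ge0_le_integral.
Qed.

(* Cauchy-Schwarz in AM-GM form, so that it can be iterated without square
   roots: the weight [tau = t * wQ / wP] changes the law from [wQ] to [wP]. *)
Lemma two_point_step (wP wQ : U -> M -> R) (K C : R) (phi psi : Y -> \bar R) :
  transition_weight wP -> transition_weight wQ ->
  (forall u m, wP u m = 0 -> wQ u m = 0)%R ->
  \int[law]_u (\sum_m wQ u m ^+ 2 / wP u m)%:E = K%:E ->
  measurable_fun setT phi -> measurable_fun setT psi ->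
  (forall y, 0 <= phi y) -> (forall y, 0 <= psi y) -> (0 <= C)%R ->
  (forall y (t : R), (0 < t)%R ->
    2%:E <= 2%:E * phi y + (t * C)%:E + t^-1%:E * psi y) ->
  forall t : R, (0 < t)%R ->
  2%:E <= 2%:E * channel_expect wQ phi + (t * (C * K))%:E +
          t^-1%:E * channel_expect wP psi.
Proof.
move=> WP WQ PQ intK mphi mpsi phi0 psi0 C0 h t t0.
have [P0 P1 mP] := WP; have [Q0 Q1 mQ] := WQ.
(* The hypothesis is integrated against the decoder law, a probability, so its constants are
   unchanged. *)
have G m u (tau : R) : (0 < tau)%R -> 2%:E <= 2%:E * \int[dec m u]_y phi y +
    (tau * C)%:E + tau^-1%:E * \int[dec m u]_y psi y.
  move=> tau0; have tC : (0 <= tau * C)%R by rewrite mulr_ge0// ltW.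
  have ti : (0 <= tau^-1)%R by rewrite invr_ge0 ltW.
  have c0 (c : R) : (0 <= c)%R -> \int[dec m u]_y c%:E = c%:E.
    by move=> _; rewrite integral_cst// prob_kernel mule1.
  rewrite -[leLHS]c0// -[(tau * C)%:E]c0// -!ge0_integralZl//.
  have mZ (c : R) (f : Y -> \bar R) : measurable_fun setT f ->
    measurable_fun setT (fun y => c%:E * f y) by move=> mf; apply: measurable_funeM.
  have Z0 (c : R) (f : Y -> \bar R) : (forall y, 0 <= f y) -> (0 <= c)%R ->
    forall y, 0 <= c%:E * f y by move=> f0 ? y; rewrite mule_ge0.
  rewrite -!ge0_integralD//=; first last.
  - by apply: mZ.
  - by move=> y _; apply: Z0.
  - by apply: mZ.
  - by move=> y _; apply: Z0.
  - by apply: emeasurable_funD => //; apply: mZ.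
  - by move=> y _; rewrite adde_ge0 ?Z0.
  apply: ge0_le_integral => //.
  - apply: emeasurable_funD; last exact: mZ.
    by apply: emeasurable_funD => //; apply: mZ.
  - by move=> y _; apply: h.
pose A u := \sum_m (wQ u m)%:E * \int[dec m u]_y phi y.
pose B u := (\sum_m wQ u m ^+ 2 / wP u m)%:E.
pose D u := \sum_m (wP u m)%:E * \int[dec m u]_y psi y.
have A0 u : 0 <= A u.
  by apply: sume_ge0 => m _; rewrite mule_ge0 ?lee_fin// decode_ge0.
have D0 u : 0 <= D u.
  by apply: sume_ge0 => m _; rewrite mule_ge0 ?lee_fin// decode_ge0.
have B0 u : 0 <= B u.
  by rewrite lee_fin sumr_ge0// => m _; rewrite divr_ge0// exprn_ge0.
have mA : measurable_fun setT A by apply: measurable_mixture.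
have mD : measurable_fun setT D by apply: measurable_mixture.
have mB : measurable_fun setT B
  by apply/measurable_EFinP; apply: measurable_chi2_weight.
have tC : (0 <= t * C)%R by rewrite mulr_ge0// ltW.
have t_ge0 : (0 <= t^-1)%R by rewrite invr_ge0 ltW.
have mZ (c : R) (f : U -> \bar R) : measurable_fun setT f ->
  measurable_fun setT (fun y => c%:E * f y) by move=> mf; apply: measurable_funeM.
have Z0 (c : R) (f : U -> \bar R) : (forall y, 0 <= f y) -> (0 <= c)%R ->
  forall y, 0 <= c%:E * f y by move=> f0 ? y; rewrite mule_ge0.
have int2 : \int[law]_u (2%:E : \bar R) = 2%:E.
  rewrite integral_cst// -[RHS]mule1; congr (_ * _); exact: probability_setT.
have intB : \int[law]_u B u = K%:E := intK.
rewrite mulrA [(t * C * K)%:E]EFinM -intB -[leLHS]int2.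
rewrite -[channel_expect wQ phi]/(\int[law]_u A u).
rewrite -[channel_expect wP psi]/(\int[law]_u D u).
rewrite -!ge0_integralZl//.
rewrite -!ge0_integralD//; first last.
- by apply: mZ.
- by move=> y _; apply: Z0.
- by apply: mZ.
- by move=> y _; apply: Z0.
- by apply: mZ.
- by move=> y _; apply: Z0.
- by apply: emeasurable_funD => //; apply: mZ.
- by move=> y _; rewrite adde_ge0 ?Z0.
apply: ge0_le_integral => //.
  by apply: emeasurable_funD; [apply: emeasurable_funD|]; apply: mZ.
move=> u _.
have sum2 : \sum_m (wQ u m)%:E * 2%:E = 2%:E.
  by rewrite -ge0_sume_distrl ?sumEFin ?Q1 ?mul1e// => m _; rewrite lee_fin.
have -> : 2%:E * A u = \sum_m 2%:E * ((wQ u m)%:E * \int[dec m u]_y phi y).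
  by rewrite ge0_sume_distrr// => m _; rewrite mule_ge0 ?lee_fin// decode_ge0.
rewrite -[leLHS]sum2 /B -EFinM mulr_sumr -sumEFin /D ge0_sume_distrr; last first.
  by move=> m _; rewrite mule_ge0 ?lee_fin// decode_ge0.
rewrite -!big_split/=; apply: lee_sum => m _.
have G1 := decode_ge0 m u phi0; have G2 := decode_ge0 m u psi0.
(* Null weights are treated apart, as [tau] has to be positive and invertible: [wP u m = 0]
   annihilates every term, [wQ u m = 0] leaves a nonnegative right side. *)
have [P00|Pn0] := eqVneq (wP u m) 0%R.
  by rewrite (PQ _ _ P00) P00 !mul0e !mule0 expr0n/= !mul0r mulr0 !adde0.
have [Q00|Qn0] := eqVneq (wQ u m) 0%R.
  rewrite Q00 !mul0e !mule0 expr0n/= !mul0r mulr0 !add0e.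
  by rewrite mule_ge0// mule_ge0 ?lee_fin.
have Pp : (0 < wP u m)%R by rewrite lt_def Pn0 P0.
have Qp : (0 < wQ u m)%R by rewrite lt_def Qn0 Q0.
pose tau := (t * wQ u m / wP u m)%R.
have tau0 : (0 < tau)%R by rewrite divr_gt0// mulr_gt0.
apply: le_trans (lee_wpmul2l _ (G m u tau tau0)) _; first by rewrite lee_fin.
have ti : (0 <= tau^-1)%R by rewrite invr_ge0 ltW.
have tauC : (0 <= tau * C)%R by rewrite mulr_ge0// ltW.
(* The factor [wQ u m] turns [tau] into the chi-square weight [t * wQ ^+ 2 / wP], and [tau^-1] into
   [t^-1 * wP], which carries the law over from [wQ] to [wP]. *)
have E (g1 g2 : \bar R) : 0 <= g1 -> 0 <= g2 ->
    (wQ u m)%:E * (2%:E * g1 + (tau * C)%:E + tau^-1%:E * g2) =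
    2%:E * ((wQ u m)%:E * g1) + (t * C * (wQ u m ^+ 2 / wP u m))%:E +
    t^-1%:E * ((wP u m)%:E * g2).
  move=> g10 g20; rewrite !ge0_muleDr ?adde_ge0 ?mule_ge0 ?lee_fin//.
  congr (_ + _ + _).
  - exact: muleCA.
  - by rewrite -EFinM; congr EFin; rewrite /tau; field.
  - rewrite !muleA -!EFinM; congr (_%:E * _); rewrite /tau; field.
    by rewrite Pn0 Qn0 gt_eqF.
by rewrite E.
Qed.

End channel.

(** * Transcripts of independent answers *)

Lemma measurable_consl (dZ dY : measure_display) (Z : measurableType dZ)
    (Y : measurableType dY) (R : realType) (t : nat)
    (F : Z * t.+1.-tuple Y -> \bar R) : measurable_fun setT F ->
  measurable_fun setT
    (fun zhy : (Z * t.-tuple Y) * Y => F (zhy.1.1, [tuple of zhy.2 :: zhy.1.2])).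
Proof.
move=> mF; apply: (measurableT_comp mF); apply: measurable_fun_pair.
  exact: measurableT_comp measurable_fst measurable_fst.
apply: measurable_cons => //.
exact: measurableT_comp measurable_snd measurable_fst.
Qed.

Lemma measurable_cons_tuple (dY : measure_display) (Y : measurableType dY)
    (R : realType) (t : nat) (phi : t.+1.-tuple Y -> \bar R) :
  measurable_fun setT phi ->
  measurable_fun setT (fun hy : t.-tuple Y * Y => phi [tuple of hy.2 :: hy.1]).
Proof.
by move=> mphi; apply: (measurableT_comp mphi); apply: measurable_cons.
Qed.

Lemma measurable_head (dY : measure_display) (Y : measurableType dY)
    (R : realType) (t : nat) (phi : t.+1.-tuple Y -> \bar R) (h : t.-tuple Y) :
  measurable_fun setT phi -> measurable_fun setT (fun y => phi [tuple of y :: h]).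
Proof.
by move=> mphi; apply: (measurableT_comp mphi); apply: measurable_cons.
Qed.

Section iter_channel.
Context {dU dY : measure_display} {U : measurableType dU} {Y : measurableType dY}
  {R : realType}.
Variables (law : probability U R) (M : finType) (dec : M -> R.-pker U ~> Y).
Local Notation iter := (iter_channel law dec).
Local Notation expect := (channel_expect law dec).
Local Open Scope ereal_scope.

Lemma measurable_expect_head w t (phi : t.+1.-tuple Y -> \bar R) :
  transition_weight w -> measurable_fun setT phi -> (forall h, 0 <= phi h) ->
  measurable_fun setT (fun h : t.-tuple Y => expect w (fun y => phi [tuple of y :: h])).
Proof.
move=> W mphi phi0.
apply: (@measurable_channel_expect _ _ _ _ _ law _ dec _ _ w
  (fun hy : t.-tuple Y * Y => phi [tuple of hy.2 :: hy.1])) => //.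
exact: measurable_cons_tuple.
Qed.

Lemma measurable_iter_channel (dZ : measure_display) (Z : measurableType dZ) w t
    (F : Z * t.-tuple Y -> \bar R) : transition_weight w ->
  measurable_fun setT F -> (forall z, 0 <= F z) ->
  measurable_fun setT (fun z => iter w (fun h => F (z, h))).
Proof.
move=> W; elim: t F => [|t IH] F mF F0 /=.
  exact: measurableT_comp mF (pair2_measurable _).
apply: (IH (fun zh : Z * t.-tuple Y => expect w (fun y => F (zh.1, [tuple of y :: zh.2])))).
  apply: (@measurable_channel_expect _ _ _ _ _ law _ dec _ _ w
    (fun zhy : (Z * t.-tuple Y) * Y => F (zhy.1.1, [tuple of zhy.2 :: zhy.1.2]))) => //.
  exact: measurable_consl.
by move=> z; apply: channel_expect_ge0.
Qed.

Lemma iter_channel_ge0 w t (phi : t.-tuple Y -> \bar R) : transition_weight w ->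
  (forall h, 0 <= phi h) -> 0 <= iter w phi.
Proof.
move=> W; elim: t phi => [|t IH] phi phi0 //=.
by apply: IH => h; apply: channel_expect_ge0.
Qed.

Lemma iter_channel_sum (I : Type) (s : seq I) w t
    (phi : I -> t.-tuple Y -> \bar R) : transition_weight w ->
  (forall i, measurable_fun setT (phi i)) -> (forall i h, 0 <= phi i h) ->
  iter w (fun h => \sum_(i <- s) phi i h) = \sum_(i <- s) iter w (phi i).
Proof.
move=> W; elim: t phi => [|t IH] phi mphi phi0 //=.
rewrite -IH => [|i|i h]; first last.
- exact: channel_expect_ge0.
- exact: measurable_expect_head.
congr iter_channel; apply/funext => h; apply: channel_expect_sum => // i.
exact: measurable_head.
Qed.

Lemma iter_channelZ (c : R) w t (phi : t.-tuple Y -> \bar R) :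
  transition_weight w -> measurable_fun setT phi -> (forall h, 0 <= phi h) ->
  (0 <= c)%R -> iter w (fun h => c%:E * phi h) = c%:E * iter w phi.
Proof.
move=> W mphi phi0 c0; elim: t phi mphi phi0 => [|t IH] phi mphi phi0 //=.
rewrite -IH => [||h]; first last.
- exact: channel_expect_ge0.
- exact: measurable_expect_head.
congr iter_channel; apply/funext => h; apply: channel_expectZ => //.
exact: measurable_head.
Qed.

Lemma iter_channel_le w t (phi psi : t.-tuple Y -> \bar R) :
  transition_weight w -> measurable_fun setT phi -> measurable_fun setT psi ->
  (forall h, 0 <= phi h) -> (forall h, phi h <= psi h) ->
  iter w phi <= iter w psi.
Proof.
move=> W; elim: t phi psi => [|t IH] phi psi mphi mpsi phi0 le_phi //=.
have psi0 h : 0 <= psi h := le_trans (phi0 h) (le_phi h).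
apply: IH => [||h|h]; try exact: measurable_expect_head.
  exact: channel_expect_ge0.
by apply: channel_expect_le => //; apply: measurable_head.
Qed.

(** Tensorisation: each round multiplies the constant by [K], one plus the chi-square divergence of
    a single message. The conclusion has the form of the hypothesis, again for every [s], which is
    what lets the step be repeated. *)
Lemma two_point_iter (wP wQ : U -> M -> R) (K : R) t :
  transition_weight wP -> transition_weight wQ ->
  (forall u m, wP u m = 0 -> wQ u m = 0)%R -> (0 <= K)%R ->
  \int[law]_u (\sum_m wQ u m ^+ 2 / wP u m)%:E = K%:E ->
  forall (C : R) (phi psi : t.-tuple Y -> \bar R),
  measurable_fun setT phi -> measurable_fun setT psi ->
  (forall h, 0 <= phi h) -> (forall h, 0 <= psi h) -> (0 <= C)%R ->
  (forall h (s : R), (0 < s)%R ->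
    2%:E <= 2%:E * phi h + (s * C)%:E + s^-1%:E * psi h) ->
  forall s : R, (0 < s)%R ->
  2%:E <= 2%:E * iter wQ phi + (s * (C * K ^+ t))%:E + s^-1%:E * iter wP psi.
Proof.
move=> WP WQ PQ K0 intK; elim: t => [|t IH] C phi psi mphi mpsi phi0 psi0 C0 H s s0.
  by rewrite expr0 mulr1; apply: H.
rewrite /= exprS [(C * (K * _))%R]mulrA; apply: IH => //; try exact: measurable_expect_head.
- by move=> h; apply: channel_expect_ge0.
- by move=> h; apply: channel_expect_ge0.
- by rewrite mulr_ge0.
move=> h s' s'0; apply: two_point_step => //; try exact: measurable_head.
by move=> y r r0; apply: H.
Qed.

End iter_channel.

(** When the law of a quantized answer does not depend on the query, adaptivity is of no use:
    whatever is asked, the transcript consists of independent answers of the channel. *)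
Lemma answers_expect_channel (R : realType) (d r T : nat) (X : set 'rV[R]_d)
    (pi : algorithm T X) (Q : quantizer R d r) (orc : oracle R d)
    (dU : measure_display) (U : measurableType dU) (law : probability U R)
    (M : finType) (dec : M -> R.-pker U ~> 'rV[R]_d) (w : U -> M -> R) s :
  transition_weight w ->
  (forall x phi, measurable_fun setT phi -> (forall y, 0 <= phi y)%E ->
    quantized_oracle_expect Q orc x phi = channel_expect law dec w phi) ->
  forall t (phi : t.-tuple 'rV[R]_d -> \bar R),
  measurable_fun setT phi -> (forall h, 0 <= phi h)%E ->
  answers_expect Q orc (pi := pi) s phi = iter_channel law dec w phi.
Proof.
move=> W H; elim=> [|t IH] phi mphi phi0 //=.
rewrite -IH; first last.
- by move=> h; apply: channel_expect_ge0.
- exact: measurable_expect_head.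
congr answers_expect; apply/funext => h; apply: H => //.
exact: measurable_head.
Qed.

(** * Quantized answers of a finitely supported oracle as a channel *)

Section quantized_finite_law.
Variables (R : realType) (d r : nat) (Q : quantizer R d r).

Definition decoder (m : r.-tuple bool) : R.-pker (q_space Q) ~> 'rV[R]_d :=
  kpullback (q_dec Q) (@pair2_measurable _ _ (q_space Q) _ m).

Definition encode_prob (g : 'rV[R]_d) (u : q_space Q) (m : r.-tuple bool) : R :=
  fine (q_enc Q (u, g) [set m]).

Lemma encode_probE g u m : ((encode_prob g u m)%:E = q_enc Q (u, g) [set m])%E.
Proof.
rewrite /encode_prob fineK//; apply: finite_kernel_measure.
exact: measurable_tuple_bool.
Qed.

Lemma encode_prob_ge0 g u m : 0 <= encode_prob g u m.
Proof. by rewrite -lee_fin encode_probE. Qed.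

Lemma sum_encode_prob g u : \sum_m encode_prob g u m = 1.
Proof.
apply: EFin_inj; rewrite -sumEFin.
under eq_bigr do rewrite encode_probE -[q_enc _ _ _]mule1.
rewrite -(@integral_tuple_bool _ _ _ (fun=> 1%E))//.
by rewrite integral_cst// prob_kernel mule1.
Qed.

Lemma measurable_encode_prob g m : measurable_fun setT (fun u => encode_prob g u m).
Proof.
apply: (measurableT_comp (fine_measurable measurableT)).
apply: (measurableT_comp (measurable_kernel (q_enc Q) _ _)) => //.
exact: measurable_tuple_bool.
Qed.

Lemma measurable_encode_vec u m :
  measurable_fun setT (fun g : 'rV[R]_d => q_enc Q (u, g) [set m]).
Proof.
apply: (measurableT_comp (measurable_kernel (q_enc Q) _ _)) => //.
exact: measurable_tuple_bool.
Qed.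

Variables (T : finType) (p : T -> R) (g : T -> 'rV[R]_d).
Hypothesis p_ge0 : forall x, 0 <= p x.
Hypothesis sum_p : \sum_x `|p x| = 1.

Definition encode_law (u : q_space Q) (m : r.-tuple bool) : R :=
  \sum_x p x * encode_prob (g x) u m.

Lemma transition_encode_law : transition_weight encode_law.
Proof.
split=> [u m|u|m].
- by apply: sumr_ge0 => x _; rewrite mulr_ge0// encode_prob_ge0.
- rewrite exchange_big/= -[RHS]sum_p; apply: eq_bigr => x _.
  by rewrite -mulr_sumr sum_encode_prob mulr1 ger0_norm.
- apply: measurable_sum => x; apply: measurable_funM => //.
  exact: measurable_encode_prob.
Qed.

Definition finite_law_oracle : oracle R d :=
  kprobability (@measurable_cst _ _ 'rV[R]_d _ setT
    (finite_law g sum_p : pprobability 'rV[R]_d R)).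

Lemma quantized_finite_law x phi : measurable_fun setT phi ->
  (forall y, 0 <= phi y)%E ->
  quantized_oracle_expect Q finite_law_oracle x phi =
  channel_expect (q_law Q) decoder encode_law phi.
Proof.
move=> mphi phi0; rewrite /quantized_oracle_expect /channel_expect.
apply: eq_integral => u _.
have D0 m : (0 <= \int[q_dec Q (u, m)]_y phi y)%E by apply: integral_ge0.
under eq_integral do rewrite integral_tuple_bool//.
rewrite integral_finite_law; first last.
- by move=> y; apply: sume_ge0 => m _; rewrite mule_ge0.
- apply: emeasurable_sum => m; apply: emeasurable_funM => //.
  exact: measurable_encode_vec.
under eq_bigr => z _.
  rewrite ge0_sume_distrr; last by move=> m _; rewrite mule_ge0.
  over.
rewrite exchange_big; apply: eq_bigr => m _ /=.
rewrite -sumEFin ge0_sume_distrl; last first.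
  by move=> z _; rewrite lee_fin mulr_ge0// encode_prob_ge0.
apply: eq_bigr => z _.
by rewrite ger0_norm// EFinM -encode_probE muleA.
Qed.

End quantized_finite_law.

(** * The hard instance: cube, linear cost, random sign oracle *)

Definition cube (R : realType) (d : nat) (a : R) : set 'rV[R]_d :=
  [set x | forall i, `|x 0 i| <= a].

Definition sign_vec (R : realType) (d : nat) (b : R) (x : {ffun 'I_d -> bool}) :
    'rV[R]_d := \row_i (if x i then b else - b).

Definition linear_cost (R : realType) (d : nat) (c : R) (v : {ffun 'I_d -> bool})
    (x : 'rV[R]_d) : R :=
  \sum_i sign_vec c v 0 i * x 0 i.

Lemma lnorm_le (R : realType) (d : nat) (p c : R) (x : 'rV[R]_d) :
  0 < p -> 0 <= c -> (forall i, `|x 0 i| <= c) ->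
  lnorm p%:E x <= c * d%:R `^ p^-1.
Proof.
move=> p0 c0 xc.
have {1}-> : c = (c `^ p) `^ p^-1.
  by rewrite -powRrM divff ?gt_eqF// powRr1.
rewrite /lnorm -powRM ?powR_ge0//.
apply: ge0_ler_powR; rewrite ?nnegrE ?invr_ge0 ?(ltW p0)//.
- by apply: sumr_ge0 => i _; apply: powR_ge0.
- by rewrite mulr_ge0 ?powR_ge0.
rewrite mulr_natr -[d in _ *+ d]card_ord -sumr_const; apply: ler_sum => i _.
by rewrite ge0_ler_powR ?nnegrE// ltW.
Qed.

(** All coordinates have modulus [b], so the norm is [b] times [d] to the power [1 - p^-1]. For
    [p = 1] the conjugate norm is a maximum, attained because [0 < d]. *)
Lemma lnorm_conjugate_sign (R : realType) (d : nat) (p b : R)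
    (x : {ffun 'I_d -> bool}) :
  1 <= p -> 0 <= b -> (0 < d)%N ->
  lnorm (hoelder_conjugate p%:E) (sign_vec b x) = b * d%:R / d%:R `^ p^-1.
Proof.
move=> p1 b0 d0.
have bi i : `|sign_vec b x 0 i| = b.
  by rewrite mxE; case: ifP => _; rewrite ?normrN ger0_norm.
have dp : 0 < d%:R :> R by rewrite ltr0n.
have [->|pn1] := eqVneq p 1.
  rewrite hoelder_conjugate1 /= invr1 powRr1 ?ler0n// mulfK ?gt_eqF//.
  apply/eqP; rewrite eq_le; apply/andP; split.
    by apply: bigmax_le => // i _; rewrite bi.
  by rewrite -[leLHS](bi (Ordinal d0)); apply: le_bigmax.
have pp : 0 < p - 1 by rewrite subr_gt0 lt_def pn1.
have -> : hoelder_conjugate p%:E = (p / (p - 1))%:E.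
  rewrite /hoelder_conjugate /= eqe gt_eqF ?(lt_le_trans _ p1)//.
  by rewrite inver gt_eqF.
rewrite /lnorm; under eq_bigr do rewrite bi.
have q0 : 0 < p / (p - 1) by rewrite divr_gt0// (lt_le_trans _ p1).
rewrite sumr_const card_ord -[in LHS]mulr_natr powRM ?powR_ge0 ?ler0n//.
rewrite -powRrM divff ?gt_eqF// powRr1// -mulrA; congr (_ * _).
have -> : (p / (p - 1))^-1 = 1 - p^-1 by field; rewrite !gt_eqF//; lra.
rewrite powRB; last by rewrite (gt_eqF dp) implybT.
by rewrite powRr1.
Qed.

Lemma opt_domain_cube (R : realType) (d : nat) (p D a : R) :
  1 <= p -> 0 <= a -> 2 * a * d%:R `^ p^-1 <= D -> opt_domain p D (@cube R d a).
Proof.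
move=> p1 a0 aD; split.
- by exists 0 => i; rewrite mxE normr0.
- have -> : @cube R d a = [set x | forall i, (`[- a, a]%classic : set R) (x ord0 i)].
    by apply/seteqP; split => x h i; have := h i; rewrite /= in_itv/= ler_norml.
  by apply: (@rV_compact R d (fun=> `[- a, a]%classic)) => i; apply: segment_compact.
- move=> x y t /set_mem /= hx /set_mem /= hy; apply/mem_set => /= i.
  have t0 : 0 <= t%:inum by [].
  have t1 : t%:inum <= 1 by [].
  have := hx i; have := hy i.
  rewrite !mxE /unstable.onem; move: (x 0 i) (y 0 i) (t%:inum) t0 t1 => {hx hy}.
  move=> X Y l l0 l1; rewrite !ler_norml => /andP[? ?] /andP[? ?].
  by apply/andP; split; nra.
- move=> x y /set_mem hx /set_mem hy; apply: le_trans aD.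
  apply: lnorm_le; rewrite ?mulr_ge0//; first by apply: lt_le_trans p1.
  move=> i; rewrite !mxE; apply: le_trans (ler_normD _ _) _; rewrite normrN.
  by have := hx i; have := hy i; lra.
Qed.

Lemma convex_linear_cost (R : realType) (d : nat) (c : R) v (X : set 'rV[R]_d) :
  convex_function X (linear_cost c v).
Proof.
move=> t x y _ _; rewrite convRE /linear_cost !mulr_sumr -big_split/=.
rewrite le_eqVlt; apply/orP; left; apply/eqP.
by apply: eq_bigr => i _; rewrite !mxE /unstable.onem; ring.
Qed.

Lemma measurable_coord (R : realType) (d : nat) (i : 'I_d) :
  measurable_fun setT (fun x : 'rV[R]_d => x 0 i).
Proof.
apply: (measurability _ (RGenOInfty.measurableE R)) => _ [_ [x ->] <-].
rewrite setTI; apply: sub_sigma_algebra.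
by apply: open_comp => // y _; apply: coord_continuous.
Qed.

Lemma integral_finite_law_EFin (dY : measure_display) (Y : measurableType dY)
    (R : realType) (T : finType) (p : T -> R) (g : T -> Y)
    (sum_p : \sum_x `|p x| = 1) (f : Y -> R) : measurable_fun setT f ->
  (\int[finite_law g sum_p]_y (f y)%:E = (\sum_x `|p x| * f (g x))%:E)%E.
Proof.
move=> mf.
have pos (h : Y -> R) : measurable_fun setT h -> (forall y, 0 <= h y) ->
    (\int[finite_law g sum_p]_y (h y)%:E = (\sum_x `|p x| * h (g x))%:E)%E.
  move=> mh h0; rewrite integral_finite_law//; first by rewrite -sumEFin.
  exact/measurable_EFinP.
rewrite integralE.
have -> : ((fun y => (f y)%:E)^\+ = fun y => (f^\+ y)%R%:E)%E.
  by apply/funext => y; rewrite funerpos.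
have -> : ((fun y => (f y)%:E)^\- = fun y => (f^\- y)%R%:E)%E.
  by apply/funext => y; rewrite funerneg.
rewrite !pos//; first last.
- exact: measurable_funrpos.
- exact: measurable_funrneg.
rewrite -EFinB -sumrB; congr EFin; apply: eq_bigr => x _.
by rewrite -mulrBr -[in RHS](funrposBneg f).
Qed.

Section hard_instance.
Variables (R : realType) (d : nat) (del b : R) (v : {ffun 'I_d -> bool}).
Hypothesis del1 : 0 < del < 1.

Lemma sum_norm_cube_law : \sum_x `|cube_law del v x| = 1.
Proof.
rewrite -[RHS](sum_cube_law del v); apply: eq_bigr => x _.
by rewrite gtr0_norm// cube_law_gt0.
Qed.

Definition hard_oracle : oracle R d :=
  finite_law_oracle (sign_vec b) sum_norm_cube_law.

(** A sign of bias [del] has mean [del] times its direction; hence the slope [del * b] of the cost,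
    against answers of modulus [b]. *)
Lemma mean_hard_oracle x :
  \row_i (\int[hard_oracle x]_g (g : 'rV[R]_d) 0 i) = sign_vec (del * b) v.
Proof.
apply/rowP => i; rewrite mxE /Rintegral.
rewrite (integral_finite_law_EFin _ _ (measurable_coord _)) /=.
under eq_bigr => y _.
  rewrite gtr0_norm ?cube_law_gt0// mxE.
  over.
rewrite (expect_cube_coord del v i (fun z => if z then b else - b)).
by rewrite big_bool /bias mxE; case: (v i) => /=; field.
Qed.

Lemma hard_oracle_class (p B : R) : 1 <= p -> 0 <= b -> (0 < d)%N ->
  b * d%:R / d%:R `^ p^-1 = B -> forall X,
  oracle_class p B X (linear_cost (del * b) v, hard_oracle).
Proof.
move=> p1 b0 d0 bB X; split; first exact: convex_linear_cost.
move=> x xX /=; split.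
  rewrite -/(hard_oracle _) mean_hard_oracle => y yX /=.
  rewrite /linear_cost -big_split/= le_eqVlt; apply/orP; left; apply/eqP.
  by apply: eq_bigr => i _; rewrite !mxE; ring.
rewrite finite_lawE.
under eq_bigr => y _.
  rewrite diracE mem_set ?mule1//=; last by rewrite lnorm_conjugate_sign// bB.
  over.
by rewrite sumEFin sum_norm_cube_law.
Qed.

End hard_instance.

(** The minimiser takes [- a] times the sign of [v] in each coordinate, so a coordinate of [x] is
    wrong when its sign agrees with [v]: it then costs at least 0, against [- (c * a)]. *)
Lemma linear_cost_gap (R : realType) (d : nat) (a c : R) (v : {ffun 'I_d -> bool})
    (x : 'rV[R]_d) :
  0 <= a -> 0 <= c -> cube a x ->
  \sum_i (c * a * ((0 <= x 0 i) == v i)%:R) <=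
  linear_cost c v x - inf (linear_cost c v @` @cube R d a).
Proof.
move=> a0 c0 xa.
pose y := sign_vec (- a) v.
have low z i : cube a z -> - (c * a) <= sign_vec c v 0 i * z 0 i.
  by move=> /(_ i); rewrite mxE ler_norml => /andP[? ?]; case: ifP => _; nra.
have inf_le : inf (linear_cost c v @` @cube R d a) <= linear_cost c v y.
  apply: ge_inf; last first.
    exists y => // i; rewrite mxE; case: ifP => _; rewrite ?opprK ?normrN ger0_norm//.
  exists (\sum_(i < d) - (c * a)) => _ [z za <-].
  by apply: ler_sum => i _; apply: low.
apply: le_trans (lerB (lexx _) inf_le); rewrite /linear_cost -sumrB.
apply: ler_sum => i _; have := low _ i xa; rewrite !mxE.
have [x0|x0] := leP 0 (x 0 i); case: (v i) => /=; nra.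
Qed.

(** * Testing one sign from the quantized transcript *)

Section testing.
Variables (R : realType) (d r : nat) (Q : quantizer R d r) (del b : R).
Hypothesis del_range : 0 < del <= 2^-1.

Let del1 : 0 < del < 1. Proof. by move: del_range => ?; lra. Qed.

Let w (v : {ffun 'I_d -> bool}) :=
  @encode_law R d r Q _ (cube_law del v) (sign_vec b).
Let e (u : q_space Q) (m : r.-tuple bool) (x : {ffun 'I_d -> bool}) :=
  encode_prob (sign_vec b x) u m.

(* One plus the chi-square divergence. *)
Definition chi2 (v : {ffun 'I_d -> bool}) (i : 'I_d) (u : q_space Q) : R :=
  \sum_m w (flip i v) u m ^+ 2 / w v u m.

Definition mean_chi2 (v : {ffun 'I_d -> bool}) (i : 'I_d) : R :=
  fine (\int[q_law Q]_u (chi2 v i u)%:E)%E.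

Lemma transition_sign_law v : transition_weight (w v).
Proof.
apply: transition_encode_law; last exact: sum_norm_cube_law.
by move=> x; rewrite ltW// cube_law_gt0.
Qed.

Let e_ge0 u m x : 0 <= e u m x. Proof. exact: encode_prob_ge0. Qed.
Let sum_e u x : \sum_m e u m x = 1. Proof. exact: sum_encode_prob. Qed.

Lemma sign_law_eq0 v i u m : w v u m = 0 -> w (flip i v) u m = 0.
Proof.
move=> h; apply: big1 => x _.
have := message_law_eq0 del_range (e_ge0 u) h x.
by rewrite /e => ->; rewrite mulr0.
Qed.

(** A square is nonnegative, so each summand is at least [2 * w (flip i v) u m - w v u m], and both
    laws have mass one. *)
Lemma chi2_ge1 v i u : 1 <= chi2 v i u.
Proof.
have [P0 P1 _] := transition_sign_law v.
have [Q0 Q1 _] := transition_sign_law (flip i v).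
have -> : 1 = \sum_m (2 * w (flip i v) u m - w v u m).
  by rewrite sumrB -mulr_sumr P1 Q1; ring.
apply: ler_sum => m _; have [h|h] := eqVneq (w v u m) 0.
  by rewrite (sign_law_eq0 i h) h; lra.
have p0 : 0 < w v u m by rewrite lt_def h P0.
rewrite ler_pdivlMr//; have := sqr_ge0 (w (flip i v) u m - w v u m); nra.
Qed.

Lemma sum_chi2_le v u :
  \sum_i chi2 v i u <= d%:R + 128 * del ^+ 2 * (minn d r)%:R.
Proof.
apply: (@sum_chi2_flip R d r del _ (e u)) => //.
by rewrite card_tuple card_bool.
Qed.

Lemma measurable_chi2 v i : measurable_fun setT (chi2 v i).
Proof.
exact: measurable_chi2_weight (transition_sign_law v) (transition_sign_law _).
Qed.

Let chi2_ge0 v i u : 0 <= chi2 v i u.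
Proof. exact: le_trans ler01 (chi2_ge1 v i u). Qed.

Let sum_int_le v : (\sum_i \int[q_law Q]_u (chi2 v i u)%:E <=
  (d%:R + 128 * del ^+ 2 * (minn d r)%:R)%:E)%E.
Proof.
rewrite -ge0_integral_sum//; first last.
- by move=> i u _; rewrite lee_fin.
- by move=> i; apply/measurable_EFinP; apply: measurable_chi2.
set C := d%:R + _.
have -> : C%:E = (\int[q_law Q]_u C%:E)%E.
  rewrite integral_cst// -[LHS]mule1; congr (_ * _)%E; apply/esym.
  exact: probability_setT.
apply: ge0_le_integral => //.
- by move=> u _; apply: sume_ge0 => i _; rewrite lee_fin.
- apply: emeasurable_sum => i; apply/measurable_EFinP; exact: measurable_chi2.
- by move=> u _; rewrite sumEFin lee_fin sum_chi2_le.
Qed.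

Let int_ge0 v i : (0 <= \int[q_law Q]_u (chi2 v i u)%:E)%E.
Proof. by apply: integral_ge0 => u _; rewrite lee_fin. Qed.

(** [fine] loses nothing: the bound on the sum of all [d] integrals makes each of them finite. *)
Lemma mean_chi2E v i : (\int[q_law Q]_u (chi2 v i u)%:E = (mean_chi2 v i)%:E)%E.
Proof.
rewrite /mean_chi2 fineK// ge0_fin_numE//.
apply: le_lt_trans (ltry (d%:R + 128 * del ^+ 2 * (minn d r)%:R)).
apply: le_trans (sum_int_le v); rewrite (bigD1 i)//= leeDl// sume_ge0//.
Qed.

Lemma mean_chi2_ge1 v i : 1 <= mean_chi2 v i.
Proof.
rewrite -lee_fin -mean_chi2E.
have <- : (\int[q_law Q]_u 1%:E = 1%:E :> \bar R)%E.
  rewrite integral_cst// mul1e; exact: probability_setT.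
apply: ge0_le_integral => //.
- by apply/measurable_EFinP; apply: measurable_chi2.
- by move=> u _; rewrite lee_fin chi2_ge1.
Qed.

Lemma sum_mean_chi2 v :
  \sum_i mean_chi2 v i <= d%:R + 128 * del ^+ 2 * (minn d r)%:R.
Proof.
rewrite -lee_fin -sumEFin; apply: le_trans (sum_int_le v).
by under eq_bigr do rewrite -mean_chi2E.
Qed.

(** Agreeing with [v i] counts as the error of the guess [x]. When [mean_chi2 v i] is close to 1 the
    two laws of the transcript are close, and no guess can err rarely under both. *)
Lemma two_point_testing (T : nat) (v : {ffun 'I_d -> bool}) (i : 'I_d)
    (x : T.-tuple 'rV[R]_d -> bool) : measurable_fun setT x ->
  (((1 - T%:R * (mean_chi2 v i - 1)) / 2)%:E <=
   iter_channel (q_law Q) (decoder Q) (w v)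
     (fun h => (x h == v i)%:R%:E : \bar R) +
   iter_channel (q_law Q) (decoder Q) (w (flip i v))
     (fun h => (x h == flip i v i)%:R%:E))%E.
Proof.
move=> mx; set K := mean_chi2 v i.
have K1 : 1 <= K by apply: mean_chi2_ge1.
have mind (c : bool) :
    measurable_fun setT (fun h => (x h == c)%:R%:E : \bar R).
  have -> : (fun h => (x h == c)%:R%:E : \bar R) =
      (fun h => if x h then (true == c)%:R%:E else (false == c)%:R%:E).
    by apply/funext => h; case: (x h).
  by apply: measurable_fun_ifT.
pose C := K ^+ T.
have C1 : 1 <= C by rewrite exprn_ege1.
have C0 : 0 < C by apply: lt_le_trans C1.
have := @two_point_iter _ _ _ _ _ (q_law Q) _ (decoder Q) (w v) (w (flip i v)) K T
  (transition_sign_law v) (transition_sign_law (flip i v))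
  (fun u m => @sign_law_eq0 v i u m) (le_trans ler01 K1) (mean_chi2E v i) 1
  (fun h => (x h == flip i v i)%:R%:E) (fun h => (x h == v i)%:R%:E)
  (mind _) (mind _).
set A := iter_channel _ _ (w v) _; set A' := iter_channel _ _ (w (flip i v)) _.
have A0 : (0 <= A)%E.
  by apply: iter_channel_ge0 => [|h]; [apply: transition_sign_law|rewrite lee_fin].
have A'0 : (0 <= A')%E.
  by apply: iter_channel_ge0 => [|h]; [apply: transition_sign_law|rewrite lee_fin].
(* With [s = C^-1] the middle term is 1, leaving [1 <= 2 * A' + C * A]. The pointwise hypothesis
   holds with constant 1, as exactly one of the two error events occurs and [s + s^-1 >= 2]. *)
move=> H; have {H} : (2%:E <= 2%:E * A' + (C^-1 * (1 * C))%:E + (C^-1)^-1%:E * A)%E.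
  apply: H; rewrite ?invr_gt0//; [by move=> h; rewrite lee_fin..|].
  move=> h s s0; rewrite -!EFinM -!EFinD lee_fin ffunE eqxx.
  have s1 : 0 < s^-1 by rewrite invr_gt0.
  have amgm : 2 <= s + s^-1.
    rewrite -subr_ge0 (_ : _ - _ = s^-1 * (s - 1) ^+ 2).
      by rewrite mulr_ge0 ?sqr_ge0// ltW.
    by field; rewrite gt_eqF.
  by case: (x h) (v i) => -[] /=; lra.
rewrite invrK mul1r mulVf ?gt_eqF//.
(* [K ^+ T <= expR (T%:R * (K - 1))] and [expR (- y) >= 1 - y]: this bounds [C^-1] from below
   linearly in [T]. *)
have bern : C * (1 - T%:R * (K - 1)) <= 1.
  have Kexp : K <= expR (K - 1) by have := expR_ge1Dx (K - 1); lra.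
  have : C <= expR (T%:R * (K - 1)).
    by rewrite expRM_natl lerXn2r ?nnegrE ?expR_ge0//; lra.
  have := expR_ge1Dx (- (T%:R * (K - 1))); rewrite expRN.
  have := expR_gt0 (T%:R * (K - 1)); set E := expR _ => E0 h1 h2.
  apply: (@le_trans _ _ (C * E^-1)); first by rewrite ler_pM2l.
  by rewrite ler_pdivrMr// mul1r.
move: A A' A0 A'0 => [a||] [a'||] //; last 3 first.
- by move=> _ _ _; rewrite addey// leey.
- by move=> _ _ _; rewrite addye// leey.
- by move=> _ _ _; rewrite addye// leey.
rewrite -!EFinM -!EFinD !lee_fin => a0 a'0 h.
rewrite ler_pdivrMr// -(ler_pM2l C0) (le_trans bern)//; nra.
Qed.

End testing.

(** * Averaging over sign vectors *)

Section averaging.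
Variables (R : realType) (d r T : nat) (del b a : R).
Let X := @cube R d a.
Variables (pi : algorithm T X) (Q : quantizer R d r).
Hypothesis del_range : 0 < del <= 2^-1.
Hypothesis del1 : 0 < del < 1.
Hypothesis b_ge0 : 0 <= b.
Hypothesis a_ge0 : 0 <= a.
Hypothesis few_samples : T%:R * (128 * del ^+ 2 * (minn d r)%:R) <= d%:R / 2.

(** Loss caused by one wrong sign: slope [del * b] times half-side [a]. *)
Let ca := del * b * a.
Let ca_ge0 : 0 <= ca.
Proof. by rewrite !mulr_ge0//; case/andP: del_range => /ltW. Qed.

Let w (v : {ffun 'I_d -> bool}) :=
  @encode_law R d r Q _ (cube_law del v) (sign_vec b).
Let iter v := @iter_channel _ _ _ _ R (q_law Q) _ (decoder Q) (w v) T.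
Let trans v : transition_weight (w v). Proof. exact: transition_sign_law. Qed.

Let wrong (v : {ffun 'I_d -> bool}) i
    (sh : a_space pi * T.-tuple 'rV[R]_d) : \bar R :=
  ((0 <= a_out pi sh 0 i) == v i)%:R%:E.
Let miss v i s : \bar R := iter v (fun h => wrong v i (s, h)).

Let measurable_out i : measurable_fun setT (fun sh => a_out pi sh 0 i).
Proof.
exact: measurableT_comp (@measurable_coord R d i)
  (@a_out_measurable _ _ _ _ pi).
Qed.

Let measurable_sign i : measurable_fun setT (fun sh => 0 <= a_out pi sh 0 i).
Proof. by apply: measurable_fun_ler => //; exact: measurable_out. Qed.

Let measurable_wrong v i : measurable_fun setT (wrong v i).
Proof.
have -> : wrong v i = (fun sh => if 0 <= a_out pi sh 0 i
    then (true == v i)%:R%:E else (false == v i)%:R%:E).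
  by apply/funext => sh; rewrite /wrong; case: (0 <= _).
by apply: measurable_fun_ifT => //; exact: measurable_sign.
Qed.

Let wrong_ge0 v i sh : (0 <= wrong v i sh)%E. Proof. by rewrite lee_fin. Qed.

Let measurable_miss v i : measurable_fun setT (miss v i).
Proof. exact: measurable_iter_channel. Qed.

Let miss_ge0 v i s : (0 <= miss v i s)%E.
Proof. exact: iter_channel_ge0. Qed.

Let measurable_slice (f : a_space pi * T.-tuple 'rV[R]_d -> \bar R) s :
  measurable_fun setT f -> measurable_fun setT (fun h => f (s, h)).
Proof. by move=> mf; apply: measurableT_comp mf (pair1_measurable s). Qed.

(** For fixed internal randomness [s], the involution [flip i] pairs each [v] with [flip i v], so
    twice the sum is a sum of two-point errors. For each [v] these add up over [i] to at least
    [(d - d / 2) / 2], by [few_samples] and the bound on the sum of divergences. *)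
Let sum_miss s :
  ((#|{ffun 'I_d -> bool}|%:R * (d%:R / 8))%:E <= \sum_v \sum_i miss v i s)%E.
Proof.
set N := #|_|; set S := (\sum_v _)%E.
have S0 : (0 <= S)%E by apply: sume_ge0 => v _; apply: sume_ge0.
have : ((N%:R * (d%:R / 4))%:E <= S + S)%E.
  have -> : (S + S = \sum_v \sum_i (miss v i s + miss (flip i v) i s))%E.
    under [RHS]eq_bigr do rewrite big_split/=.
    rewrite big_split/=; congr (_ + _)%E.
    rewrite /S exchange_big/= [RHS]exchange_big/=; apply: eq_bigr => i _.
    exact: (reindex_inj (can_inj (flipK i))).
  have -> : (N%:R * (d%:R / 4))%:E =
      (\sum_(v : {ffun 'I_d -> bool}) (d%:R / 4)%:E)%E :> \bar R.
    by rewrite sumEFin sumr_const mulr_natl.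
  apply: lee_sum => v _.
  apply: (@le_trans _ _ (\sum_i ((1 - T%:R * (mean_chi2 Q del b v i - 1)) / 2)%:E)%E).
    rewrite sumEFin lee_fin -mulr_suml sumrB -mulr_sumr sumrB !sumr_const card_ord.
    have := sum_mean_chi2 Q b del_range v; set Z := \sum_i _ => hZ.
    have : T%:R * (Z - d%:R) <= d%:R / 2.
      apply: le_trans few_samples; rewrite ler_wpM2l//; lra.
    lra.
  apply: lee_sum => i _.
  apply: (two_point_testing Q b del_range v i
    (x := fun h => 0 <= a_out pi (s, h) 0 i)).
  exact: measurableT_comp (measurable_sign i) (pair1_measurable s).
move: S S0 => [S||] //=; last by move=> _ _; rewrite leey.
by rewrite -EFinD !lee_fin; lra.
Qed.

(** For every transcript the loss is at least [ca] per wrong sign, and the answers of the hard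
    oracle follow the iterated channel. *)
Let opt_error_ge v :
  (\int[a_law pi]_s (ca%:E * \sum_i miss v i s) <=
   opt_error pi Q (linear_cost (del * b) v) (hard_oracle b v del1))%E.
Proof.
pose f := linear_cost (del * b) v; pose c := inf (f @` X).
pose Phi sh : \bar R := (f (a_out pi sh) - c)%:E.
have gap sh : (\sum_i ca%:E * wrong v i sh <= Phi sh)%E.
  under eq_bigr do rewrite -EFinM.
  rewrite sumEFin lee_fin.
  apply: linear_cost_gap => //; last exact: a_out_dom.
  by rewrite mulr_ge0//; case/andP: del_range => /ltW.
have Phi0 sh : (0 <= Phi sh)%E.
  by apply: le_trans (gap sh); apply: sume_ge0 => i _; rewrite mule_ge0 ?lee_fin.
have mPhi : measurable_fun setT Phi.
  apply/measurable_EFinP; apply: measurable_funB => //.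
  apply: measurable_sum => i; apply: measurable_funM => //; exact: measurable_out.
have mcw i : measurable_fun setT (fun sh => ca%:E * wrong v i sh)%E.
  exact: measurable_funeM.
rewrite /opt_error.
under [leRHS]eq_integral => s _.
  rewrite (@answers_expect_channel R d r T X pi Q _ _ _ (q_law Q) _ (decoder Q) (w v))//.
  - over.
  - move=> x phi mphi phi0; apply: quantized_finite_law => // z.
    by rewrite ltW// cube_law_gt0.
  - exact: (measurable_slice s mPhi).
  - by move=> h; apply: (Phi0 (s, h)).
apply: ge0_le_integral => //.
- by move=> s _; rewrite mule_ge0 ?lee_fin// sume_ge0.
- by apply: measurable_funeM; apply: emeasurable_sum.
- exact: (measurable_iter_channel _ _ (trans v) mPhi Phi0).
move=> s _; rewrite ge0_sume_distrr//.
have -> : (\sum_i ca%:E * miss v i s =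
    iter v (fun h => \sum_i ca%:E * wrong v i (s, h)))%E.
  rewrite /iter iter_channel_sum//; first last.
  - by move=> i h; rewrite mule_ge0 ?lee_fin.
  - by move=> i; apply: (measurable_slice s (mcw i)).
  apply: eq_bigr => i _; rewrite iter_channelZ//.
  exact: (measurable_slice s (measurable_wrong v i)).
apply: iter_channel_le => //.
- apply: (measurable_slice s (f := fun sh => \sum_i ca%:E * wrong v i sh)%E).
  exact: emeasurable_sum.
- exact: (measurable_slice s mPhi).
- by move=> h; apply: sume_ge0 => i _; rewrite mule_ge0 ?lee_fin.
Qed.

(** For fixed [pi] and [Q], some [v] does at least as badly as the uniform average over all [v]. *)
Lemma exists_hard_instance : exists v : {ffun 'I_d -> bool},
  ((del * b * a * d%:R / 8)%:E <=
   opt_error pi Q (linear_cost (del * b) v) (hard_oracle b v del1))%E.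
Proof.
apply: contrapT => /forallNP no.
pose I v := (\int[a_law pi]_s (ca%:E * \sum_i miss v i s))%E.
have I0 v : (0 <= I v)%E.
  by apply: integral_ge0 => s _; rewrite mule_ge0 ?lee_fin// sume_ge0.
have Ilt v : (I v < (ca * d%:R / 8)%:E)%E.
  apply: le_lt_trans (opt_error_ge v) _; rewrite ltNge; apply/negP; exact: no.
have Ifin v : I v \is a fin_num.
  by rewrite ge0_fin_numE//; apply: lt_trans (Ilt v) (ltry _).
have : ((#|{ffun 'I_d -> bool}|%:R * (ca * d%:R / 8))%:E <= \sum_v I v)%E.
  rewrite -ge0_integral_sum//; first last.
  - by move=> v s _; rewrite mule_ge0 ?lee_fin// sume_ge0.
  - by move=> v; apply: measurable_funeM; apply: emeasurable_sum.
  set C := _ * _.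
  have -> : C%:E = (\int[a_law pi]_s C%:E)%E.
    rewrite integral_cst// -[LHS]mule1; congr (_ * _)%E; apply/esym.
    exact: probability_setT.
  apply: ge0_le_integral => //.
  - by move=> s _; rewrite lee_fin /C mulr_ge0// divr_ge0// mulr_ge0.
  - apply: emeasurable_sum => v; apply: measurable_funeM; exact: emeasurable_sum.
  move=> s _; rewrite -ge0_sume_distrr; last by move=> v _; rewrite sume_ge0.
  have -> : C%:E = (ca%:E * (#|{ffun 'I_d -> bool}|%:R * (d%:R / 8))%:E)%E.
    by rewrite -EFinM /C; congr EFin; ring.
  by rewrite lee_wpmul2l ?lee_fin.
under eq_bigr do rewrite -[I _]fineK//.
rewrite sumEFin lee_fin mulr_natl -sumr_const leNgt => /negP; apply.
(* The strict inequalities survive summation because there is at least one sign vector. *)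
apply: ltr_sum.
  by apply/hasP; exists [ffun=> true] => //; rewrite mem_index_enum.
by move=> v _; rewrite -lte_fin fineK.
Qed.

End averaging.

(* The error never exceeds D * B, since the mean answer is a subgradient of
   q-norm at most B. So the bound can hold with an absolute c0 only if T is at
   least of order d / min(d, r); this is the last hypothesis. *)
Theorem theorem6p2 (R : realType) :
  exists2 c0 : R, 0 < c0 &
    forall (p D B : R) (d T r : nat),
      1 <= p -> p < 2 -> 0 < D -> 0 < B ->
      (0 < d)%N -> (0 < T)%N -> (0 < r)%N ->
      d%:R / (minn d r)%:R <= T%:R :> R ->
      ((c0 * D * B / Num.sqrt T%:R * Num.sqrt (d%:R / (minn d r)%:R))%:E
         <= minmax_error d T r p D B)%E.
Proof.
(* The product of the 16 in [del], the 2 in [a] and the 8 of [exists_hard_instance]. *)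
exists 256^-1; first by rewrite invr_gt0.
move=> p D B d T r p1 _ D0 B0 d0 T0 r0 dT.
have dp : 0 < d%:R :> R by rewrite ltr0n.
have Tp : 0 < T%:R :> R by rewrite ltr0n.
have mp : 0 < (minn d r)%:R :> R by rewrite ltr0n leq_min d0.
pose kap : R := d%:R / (minn d r)%:R / T%:R.
have kap0 : 0 < kap by rewrite !divr_gt0.
have kap1 : kap <= 1 by rewrite ler_pdivrMr// mul1r.
(* [16 ^+ 2 = 2 * 128] makes [few] an equality, and [kap <= 1] keeps [del] below 1/2. *)
pose del := Num.sqrt kap / 16.
have sq : Num.sqrt kap ^+ 2 = kap by rewrite sqr_sqrtr// ltW.
have sq0 : 0 < Num.sqrt kap by rewrite sqrtr_gt0.
have del_range : 0 < del <= 2^-1.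
  by rewrite /del; apply/andP; split; nra.
have del1 : 0 < del < 1 by lra.
pose N : R := d%:R `^ p^-1.
have N0 : 0 < N by rewrite powR_gt0.
(* [b] gives the answers conjugate norm exactly [B], and [a] is chosen so that [2 * a * N = D]; in
   the product [b * a] the factor [N] cancels, and with it [p]. *)
pose b := B * N / d%:R; pose a := D / (2 * N).
have b0 : 0 <= b by rewrite !(mulr_ge0, invr_ge0)// ltW.
have a0 : 0 <= a by rewrite divr_ge0// ?mulr_ge0// ltW.
have few : T%:R * (128 * del ^+ 2 * (minn d r)%:R) <= d%:R / 2.
  rewrite /del expr_div_n sq /kap le_eqVlt; apply/orP; left; apply/eqP.
  by field; rewrite !gt_eqF.
have -> : 256^-1 * D * B / Num.sqrt T%:R * Num.sqrt (d%:R / (minn d r)%:R) =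
    del * b * a * d%:R / 8.
  have -> : del = Num.sqrt (d%:R / (minn d r)%:R) / Num.sqrt T%:R / 16.
    by rewrite /del /kap sqrtrM ?divr_ge0// sqrtrV.
  rewrite /b /a.
  by field; rewrite !gt_eqF// sqrtr_gt0.
apply: le_trans (ereal_sup_ubound _); last first.
  exists (@cube R d a); last by [].
  apply: opt_domain_cube => //; rewrite -/N /a le_eqVlt.
  apply/orP; left; apply/eqP.
  by field; rewrite gt_eqF.
apply/ereal_infP => _ [pi <-]; apply/ereal_infP => _ [Q <-].
have [v hv] := exists_hard_instance pi Q del_range del1 b0 a0 few.
apply: le_trans hv _; apply: ereal_sup_ubound.
exists (linear_cost (del * b) v, hard_oracle b v del1); last by [].
apply: hard_oracle_class => //; rewrite -/N /b.
by field; rewrite !gt_eqF.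
Qed.
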